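(* Every simple object of ${}^{H_8}_{H_8}\mathcal{YD}$ is isomorphic to exactly one of the following $22$ pairwise non-isomorphic simple Yetter–Drinfeld modules: the $8$ one-dimensional modules $M\langle b,g\rangle$ with $(b,g)\in\{(\pm1,1),(\pm1,xy),(\pm\mathrm{i},x),(\pm\mathrm{i},y)\}$, and the $14$ two-dimensional modules $M\langle(1,xy)\rangle$, $M\langle(x,y)\rangle$, $M\langle(g_1,g_2)\rangle$ for $(g_1,g_2)\in\{(1,y),(x,1),(xy,x),(y,xy)\}$, $W^{b_1,b_2}$ for $b_1,b_2\in\{\pm1\}$, and $W_1^a$, $W_2^a$ for $a\in\{-1+\sqrt2,-1-\sqrt2\}$. (In particular, each of these data defines a simple Yetter–Drinfeld module.)
   Context: $\mathbb{K}$ is an algebraically closed field of characteristic $0$, $\mathrm{i}\in\mathbb{K}$ a fixed square root of $-1$, $\sqrt2$ a fixed square root of $2$, and $\sqrt{\mathrm{i}}$ a fixed square root of $\mathrm{i}$ (e.g. $\cos\frac\pi4+\mathrm{i}\sin\frac\pi4$). $H_8$ is the Hopf algebra generated by $x,y,z$ with $x^2=y^2=1$, $z^2=\frac12(1+x+y-xy)$, $xy=yx$, $zx=yz$, $zy=xz$, $\Delta(x)=x\otimes x$, $\Delta(y)=y\otimes y$, $\Delta(z)=\frac12(1\otimes1+1\otimes x+y\otimes1-y\otimes x)(z\otimes z)$, $\varepsilon=1$ on generators, $S(x)=x,S(y)=y,S(z)=z$. Put $f_{jk}=\frac14(1+(-1)^jx)(1+(-1)^ky)$ and $w=(f_{00}+\sqrt{\mathrm{i}}f_{10}+\frac{1}{\sqrt{\mathrm{i}}}f_{01}+\mathrm{i}f_{11})z\in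 H_8$. ${}^{H_8}_{H_8}\mathcal{YD}$ is the category of left Yetter–Drinfeld modules over $H_8$ (left module and left comodule with $\rho(h\cdot m)=h_{(1)}m_{(-1)}S(h_{(3)})\otimes h_{(2)}\cdot m_{(0)}$). Modules (action and coaction on a basis): - $M\langle b,g\rangle=\mathbb{K}p$: $x\cdot p=y\cdot p=b^2p$, $z\cdot p=bp$, $\rho(p)=g\otimes p$. - $M\langle(1,xy)\rangle$, basis $p_1,p_2$: $x\cdot p_k=y\cdot p_k=-p_k$, $z\cdot p_1=\mathrm{i}p_2$, $z\cdot p_2=\mathrm{i}p_1$, $\rho(p_1)=1\otimes p_1$, $\rho(p_2)=xy\otimes p_2$. - $M\langle(x,y)\rangle$, basis $p_1,p_2$: $x\cdot p_k=y\cdot p_k=p_k$, $z\cdot p_1=p_2$, $z\cdot p_2=p_1$, $\rho(p_1)=x\otimes p_1$, $\rho(p_2)=y\otimes p_2$. - $M\langle(g_1,g_2)\rangle$, basis $p_1,p_2$: $x\cdot p_1=p_1$, $x\cdot p_2=-p_2$, $y\cdot p_1=-p_1$, $y\cdot p_2=p_2$, $z\cdot p_1=p_2$, $z\cdot p_2=p_1$, $\rho(p_k)=g_k\otimes p_k$. - $W^{b_1,b_2}$, basis $p_1,p_2$: $x\cdot p_1=y\cdot p_1=p_1$, $x\cdot p_2=y\cdot p_2=-p_2$, $z\cdot p_1=b_2p_1$, $z\cdot p_2=-\mathrm{i}b_1b_2p_2$, $\rho(p_1)=(f_{00}-\mathrm{i}b_1f_{11})z\otimes p_1+(f_{10}+\mathrm{i}b_1f_{01})z\otimes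 p_2$, $\rho(p_2)=(f_{00}+\mathrm{i}b_1f_{11})z\otimes p_2+(f_{10}-\mathrm{i}b_1f_{01})z\otimes p_1$. - $W_1^a$, basis $w_1,w_2$: $x\cdot w_1=-w_1$, $y\cdot w_1=w_1$, $z\cdot w_1=\frac12(1-\mathrm{i})(a+1)w_2$, $x\cdot w_2=w_2$, $y\cdot w_2=-w_2$, $z\cdot w_2=\frac12(1+\mathrm{i})(a+1)w_1$; $\rho(w_1)=\frac12(x+y)w\otimes w_1+\frac{\sqrt{\mathrm{i}}}{2}(x-y)w\otimes w_2$, $\rho(w_2)=\frac12(1+xy)w\otimes w_2+\frac{\sqrt{\mathrm{i}}}2(1-xy)w\otimes w_1$. - $W_2^a$, basis $w_1,w_2$: $x\cdot w_1=w_1$, $y\cdot w_1=-w_1$, $z\cdot w_1=\frac12(1-\mathrm{i})(a+1)w_2$, $x\cdot w_2=-w_2$, $y\cdot w_2=w_2$, $z\cdot w_2=\frac12(1+\mathrm{i})(a+1)w_1$; coaction given by the same formulas as for $W_1^a$. *)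

(* Defs.v *)
From HB Require Import structures.
From mathcomp Require Import all_boot all_order all_algebra.
Set Implicit Arguments. Unset Strict Implicit. Unset Printing Implicit Defensive.
Import Order.TTheory GRing.Theory Num.Theory.
Local Open Scope ring_scope.

(* Group part <x, y> = Z/2 x Z/2 : an element (a, b) stands for x^a y^b.     *)
(* PBW basis of H_8 : (g, c) stands for g z^c, i.e. x^a y^b z^c.             *)
Definition G4 := (bool * bool)%type.
Definition B8 := (G4 * bool)%type.

Definition gmul (g h : G4) : G4 := (g.1 (+) h.1, g.2 (+) h.2).
Definition gswap (g : G4) : G4 := (g.2, g.1).       (* z g = gswap g z *)
Definition g1 : G4 := (false, false).
Definition gx : G4 := (true, false).
Definition gy : G4 := (false, true).
Definition gxy : G4 := (true, true).

Section H8.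
Variable K : fieldType.

(* elements of H_8 : coordinate vectors in the PBW basis *)
Definition H8 := {ffun B8 -> K^o}.

Definition eb (e : B8) : H8 := [ffun j => (j == e)%:R].

Definition half : K := (2%:R)^-1.

(* product of two basis elements, using  z x = y z, z y = x z,
   z^2 = 1/2 (1 + x + y - xy) *)
Definition mulB (e f : B8) : H8 :=
  let g := gmul e.1 (if e.2 then gswap f.1 else f.1) in
  if e.2 && f.2 then
    half *: (eb (g, false) + eb (gmul g gx, false) + eb (gmul g gy, false)
             - eb (gmul g gxy, false))
  else eb (g, e.2 || f.2).

Definition mulH (h k : H8) : H8 := \sum_(e : B8) \sum_(f : B8) (h e * k f) *: mulB e f.

(* comultiplication: DeltaB e p q = coefficient of e_p (x) e_q in Delta(e).
   Delta(g) = g (x) g,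
   Delta(g z) = (g (x) g) 1/2 (1(x)1 + 1(x)x + y(x)1 - y(x)x)(z (x) z)
             = 1/2 (gz (x) gz + gz (x) gxz + gyz (x) gz - gyz (x) gxz) *)
Definition DeltaB (e p q : B8) : K :=
  if e.2 then
    let g := e.1 in
    half * (((p == (g, true)) && (q == (g, true)))%:R
            + ((p == (g, true)) && (q == (gmul g gx, true)))%:R
            + ((p == (gmul g gy, true)) && (q == (g, true)))%:R
            - ((p == (gmul g gy, true)) && (q == (gmul g gx, true)))%:R)
  else ((p == e) && (q == e))%:R.

Definition Delta2 (e p q r : B8) : K := \sum_(m : B8) DeltaB e m r * DeltaB m p q.

(* counit: eps = 1 on generators, hence on every PBW basis element *)
Definition epsB (e : B8) : K := 1.

(* antipode: S(g) = g, S(g z) = S(z) S(g) = z g = gswap g z *)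
Definition SB (e : B8) : B8 := if e.2 then (gswap e.1, true) else e.

Definition unitB : B8 := (g1, false).

Definition hx : H8 := eb (gx, false).
Definition hy : H8 := eb (gy, false).
Definition hxy : H8 := eb (gxy, false).
Definition hz : H8 := eb (g1, true).
Definition h1 : H8 := eb unitB.
Definition hg (g : G4) : H8 := eb (g, false).

Definition fjk (j k : bool) : H8 :=
  (4%:R)^-1 *: mulH (h1 + (-1) ^+ j *: hx) (h1 + (-1) ^+ k *: hy).

(* The action is given by the (linear) action maps of the basis elements;   *)
(* a coaction rho : V -> H_8 (x) V is encoded by the unique maps co_k with  *)
(* rho(v) = sum_k e_k (x) co_k(v).                                           *)
Record ydstr (V : lmodType K) := YDStr {
  yd_act : B8 -> V -> V;
  yd_co : B8 -> V -> V }.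

Definition actH (V : lmodType K) (D : ydstr V) (h : H8) (v : V) : V :=
  \sum_(e : B8) h e *: yd_act D e v.

Definition is_yd (V : lmodType K) (D : ydstr V) : Prop :=
  (forall e, linear (yd_act D e)) /\
      (forall e, linear (yd_co D e)) /\
      (forall v, yd_act D unitB v = v) /\
      (forall e f v, yd_act D e (yd_act D f v) = actH D (mulB e f) v) /\
      (forall v, \sum_(k : B8) epsB k *: yd_co D k v = v) /\
      (forall a b v, yd_co D b (yd_co D a v) = \sum_(k : B8) DeltaB k a b *: yd_co D k v) /\
      (* Yetter-Drinfeld compatibility
         rho(h.m) = h1 m(-1) S(h3) (x) h2.m(0), for h a basis element *)
      (forall e k v,
        yd_co D k (yd_act D e v) =
        \sum_(p : B8) \sum_(q : B8) \sum_(r : B8) \sum_(j : B8)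
          (Delta2 e p q r * mulH (mulH (eb p) (eb j)) (eb (SB r)) k)
            *: yd_act D q (yd_co D j v)).

Definition is_subyd (V : lmodType K) (D : ydstr V) (W : V -> Prop) : Prop :=
  [/\ W 0,
      (forall (a : K) u v, W u -> W v -> W (a *: u + v)),
      (forall e v, W v -> W (yd_act D e v))
    & (forall k v, W v -> W (yd_co D k v))].

Definition simple_yd (V : lmodType K) (D : ydstr V) : Prop :=
  [/\ is_yd D,
      (exists v : V, v <> 0)
    & forall W, is_subyd D W -> (forall v, W v -> v = 0) \/ (forall v, W v)].

Definition yd_iso (V V' : lmodType K) (D : ydstr V) (D' : ydstr V') : Prop :=
  exists f : V -> V',
    [/\ linear f, bijective f,
        (forall e v, f (yd_act D e v) = yd_act D' e (f v))
      & (forall k v, f (yd_co D k v) = yd_co D' k (f v))].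

(* Concrete modules on K^n (column vectors, basis p_1..p_n = delta_mx).     *)
(* X, Y, Z : matrices of the action of x, y, z;                             *)
(* h j l : the element of H_8 such that rho(p_j) = sum_l h j l (x) p_l.      *)
Record ydmat := YDMat {
  ydm_n : nat;
  ydm_X : 'M[K]_ydm_n;
  ydm_Y : 'M[K]_ydm_n;
  ydm_Z : 'M[K]_ydm_n;
  ydm_h : 'I_ydm_n -> 'I_ydm_n -> H8 }.

Definition ydm_act (M : ydmat) (e : B8) : 'M[K]_(ydm_n M) :=
  (if e.1.1 then ydm_X M else 1%:M) *m (if e.1.2 then ydm_Y M else 1%:M)
    *m (if e.2 then ydm_Z M else 1%:M).

Definition ydm_co (M : ydmat) (k : B8) : 'M[K]_(ydm_n M) :=
  \matrix_(l, j) @ydm_h M j l k.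

Definition model (M : ydmat) : ydstr 'cV[K]_(ydm_n M) :=
  YDStr (fun e v => ydm_act M e *m v) (fun k v => ydm_co M k *m v).

Definition diag2 (a b : K) : 'M[K]_2 := \matrix_(i, j) (if i == j then (if i == 0 then a else b) else 0).
Definition anti2 (a b : K) : 'M[K]_2 :=
  \matrix_(i, j) (if i == j then 0 else (if j == 0 then a else b)).
Definition mk2 (h11 h12 h21 h22 : H8) : 'I_2 -> 'I_2 -> H8 :=
  fun j l => if j == 0 then (if l == 0 then h11 else h12) else (if l == 0 then h21 else h22).

Definition M1 (b : K) (g : G4) : ydmat :=
  @YDMat 1 (b ^+ 2)%:M (b ^+ 2)%:M b%:M (fun _ _ => hg g).

Variables (i s2 si : K). (* fixed square roots of -1, 2 and i *)

Definition M2_1xy : ydmat :=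
  @YDMat 2 (diag2 (-1) (-1)) (diag2 (-1) (-1)) (anti2 i i) (mk2 h1 0 0 hxy).
Definition M2_xy : ydmat :=
  @YDMat 2 (diag2 1 1) (diag2 1 1) (anti2 1 1) (mk2 hx 0 0 hy).
Definition M2_g (ga gb : G4) : ydmat :=
  @YDMat 2 (diag2 1 (-1)) (diag2 (-1) 1) (anti2 1 1) (mk2 (hg ga) 0 0 (hg gb)).
Definition W_b (b1 b2 : K) : ydmat :=
  @YDMat 2 (diag2 1 (-1)) (diag2 1 (-1)) (diag2 b2 (- i * b1 * b2))
    (mk2 (mulH (fjk false false - (i * b1) *: fjk true true) hz)
         (mulH (fjk true false + (i * b1) *: fjk false true) hz)
         (mulH (fjk true false - (i * b1) *: fjk false true) hz)
         (mulH (fjk false false + (i * b1) *: fjk true true) hz)).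

Definition hw : H8 :=
  mulH (fjk false false + si *: fjk true false + si^-1 *: fjk false true
        + i *: fjk true true) hz.

Definition Wh : 'I_2 -> 'I_2 -> H8 :=
  mk2 (half *: mulH (hx + hy) hw) ((si * half) *: mulH (hx - hy) hw)
      ((si * half) *: mulH (h1 - hxy) hw) (half *: mulH (h1 + hxy) hw).

Definition Wz (a : K) : 'M[K]_2 :=
  anti2 (half * (1 - i) * (a + 1)) (half * (1 + i) * (a + 1)).

Definition W1 (a : K) : ydmat := @YDMat 2 (diag2 (-1) 1) (diag2 1 (-1)) (Wz a) Wh.
Definition W2 (a : K) : ydmat := @YDMat 2 (diag2 1 (-1)) (diag2 (-1) 1) (Wz a) Wh.

Definition simples_list : seq ydmat :=
  [:: M1 1 g1; M1 (-1) g1; M1 1 gxy; M1 (-1) gxy;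
      M1 i gx; M1 (- i) gx; M1 i gy; M1 (- i) gy;
      M2_1xy; M2_xy;
      M2_g g1 gy; M2_g gx g1; M2_g gxy gx; M2_g gy gxy;
      W_b 1 1; W_b 1 (-1); W_b (-1) 1; W_b (-1) (-1);
      W1 (-1 + s2); W1 (-1 - s2); W2 (-1 + s2); W2 (-1 - s2)].

Definition simples (n : 'I_22) : ydmat := nth (M1 1 g1) simples_list n.

End H8.

(* Main.v *)
(* A Yetter-Drinfeld module is a module over the Drinfeld double, which is spanned by the
   64 operators act_e co_k with e, k in the PBW basis.  In the double one can write down
   matrix units E^n_jk, one block for each of the 22 listed modules M_n with action
   matrices rho_n: for every act_e or co_k, called d, d E^n_kj = sum_l rho_n(d)_lk E^n_lj,
   the sum of all E^n_jj is 1, and E^n_jk acts on M_m as the elementary matrix e_jk if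
   m = n and as 0 otherwise.  Hence the M_n are simple and pairwise non-isomorphic; and if
   v <> 0 lies in a simple module V, then some E^n_jj v is nonzero, p_k |-> E^n_kj v is a
   nonzero morphism M_n -> V, and Schur's lemma makes it an isomorphism.  Everything is
   defined over Z[zeta_8, 1/2], where these identities are decided by computation. *)
Require Import Defs.
From HB Require Import structures.
From Stdlib Require Import ZArith.
From Stdlib Require Classical_Prop.
From mathcomp Require Import all_boot all_order all_algebra.
From mathcomp Require Import ssrZ zify ring.
Set Implicit Arguments. Unset Strict Implicit. Unset Printing Implicit Defensive.
Import Order.TTheory GRing.Theory Num.Theory.
Local Open Scope ring_scope.

(** * Exact computation in the double *)

Delimit Scope Z_scope with coqZ.

(* [Cyc a0 a1 a2 a3 n] stands for (a0 + a1 z + a2 z^2 + a3 z^3) / 2^n with z^4 = -1. *)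
Inductive cyc := Cyc of Z & Z & Z & Z & nat.

Definition pow2 (n : nat) : Z := iter n Z.double 1%coqZ.

(** Subtraction on [nat] is truncated, so [m + (n - m)] is the larger exponent and each numerator is
    multiplied by the power of two that it lacks. *)
Definition cadd (a b : cyc) : cyc :=
  let: Cyc a0 a1 a2 a3 m := a in let: Cyc b0 b1 b2 b3 n := b in
  let u := pow2 (n - m) in let w := pow2 (m - n) in
  Cyc (a0 * u + b0 * w)%coqZ (a1 * u + b1 * w)%coqZ (a2 * u + b2 * w)%coqZ
      (a3 * u + b3 * w)%coqZ (m + (n - m)).

Definition copp (a : cyc) : cyc :=
  let: Cyc a0 a1 a2 a3 m := a in Cyc (- a0)%coqZ (- a1)%coqZ (- a2)%coqZ (- a3)%coqZ m.

Definition cmul (a b : cyc) : cyc :=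
  let: Cyc a0 a1 a2 a3 m := a in let: Cyc b0 b1 b2 b3 n := b in
  Cyc (a0 * b0 - (a1 * b3 + a2 * b2 + a3 * b1))%coqZ
      (a0 * b1 + a1 * b0 - (a2 * b3 + a3 * b2))%coqZ
      (a0 * b2 + a1 * b1 + a2 * b0 - a3 * b3)%coqZ
      (a0 * b3 + a1 * b2 + a2 * b1 + a3 * b0)%coqZ (m + n).

Definition czero (a : cyc) : bool :=
  let: Cyc a0 a1 a2 a3 _ := a in
  [&& Z.eqb a0 0, Z.eqb a1 0, Z.eqb a2 0 & Z.eqb a3 0].

(** Fractions are never reduced, so equality is tested on the numerators of the difference. *)
Definition ceq (a b : cyc) : bool := czero (cadd a (copp b)).

Definition c0 : cyc := Cyc 0 0 0 0 0.
Definition c1 : cyc := Cyc 1 0 0 0 0.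
Definition chalf : cyc := Cyc 1 0 0 0 1.
Definition cz : cyc := Cyc 0 1 0 0 0.
Definition ci : cyc := Cyc 0 0 1 0 0.
(** A square root of 2 is z + z^-1, and z^-1 = - z^3. *)
Definition cs2 : cyc := Cyc 0 1 0 (-1) 0.

(** * Formal linear combinations and their normal forms *)

Definition lincomb (T : Type) := seq (cyc * T).

Definition lret (T : Type) (t : T) : lincomb T := [:: (c1, t)].
Definition lscale (T : Type) (c : cyc) (s : lincomb T) : lincomb T :=
  [seq (cmul c t.1, t.2) | t <- s].
Definition lmap (T U : Type) (g : T -> U) (s : lincomb T) : lincomb U :=
  [seq (t.1, g t.2) | t <- s].
Definition lbind (T U : Type) (s : lincomb T) (F : T -> lincomb U) : lincomb U :=
  flatten [seq lscale t.1 (F t.2) | t <- s].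

Definition B8s : seq B8 :=
  [:: (g1, false); (g1, true); (gx, false); (gx, true);
      (gy, false); (gy, true); (gxy, false); (gxy, true)].

(** Position in [B8s]; [look] relies on the agreement of the two orders. *)
Definition idx8 (e : B8) : nat :=
  let: ((a, b), c) := e in
  if a then (if b then (if c then 7 else 6) else (if c then 3 else 2))
  else (if b then (if c then 5 else 4) else (if c then 1 else 0)).

Definition eq8 (e f : B8) : bool :=
  let: ((a, b), c) := e in let: ((a', b'), c') := f in
  [&& eqb a a', eqb b b' & eqb c c'].

Definition coef (s : lincomb B8) (k : B8) : cyc :=
  foldr (fun t a => if eq8 t.2 k then cadd t.1 a else a) c0 s.
Definition eql8 (s t : lincomb B8) : bool :=
  all (fun k => ceq (coef s k) (coef t k)) B8s.
(** Merges repeated basis elements and drops zero coefficients, which keeps the tables sparse. *)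
Definition norm8 (s : lincomb B8) : lincomb B8 :=
  [seq (coef s k, k) | k <- B8s & ~~ czero (coef s k)].

Definition slice (s : lincomb (B8 * B8)) (e : B8) : lincomb B8 :=
  [seq (t.1, t.2.2) | t <- s & eq8 t.2.1 e].
Definition eql (s t : lincomb (B8 * B8)) : bool :=
  all (fun e => eql8 (slice s e) (slice t e)) B8s.
Definition norm (s : lincomb (B8 * B8)) : lincomb (B8 * B8) :=
  flatten [seq lmap (pair e) (norm8 (slice s e)) | e <- B8s].

Definition memo (A : Type) (f : B8 -> A) : seq A := map f B8s.
Definition look (A : Type) (x0 : A) (s : seq A) (e : B8) : A := nth x0 s (idx8 e).
Definition look2 (A : Type) (x0 : A) (s : seq (seq A)) (e f : B8) : A :=
  look x0 (look [::] s e) f.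

(** * Structure constants of H_8 and left multiplication in its double *)

Definition mulS (e f : B8) : lincomb B8 :=
  let g := gmul e.1 (if e.2 then gswap f.1 else f.1) in
  if e.2 && f.2 then
    [:: (chalf, (g, false)); (chalf, (gmul g gx, false));
        (chalf, (gmul g gy, false)); (copp chalf, (gmul g gxy, false))]
  else [:: (c1, (g, e.2 || f.2))].

Definition DeltaS (e : B8) : lincomb (B8 * B8) :=
  if e.2 then
    let g := e.1 in
    [:: (chalf, ((g, true), (g, true))); (chalf, ((g, true), (gmul g gx, true)));
        (chalf, ((gmul g gy, true), (g, true)));
        (copp chalf, ((gmul g gy, true), (gmul g gx, true)))]
  else [:: (c1, (e, e))].

Definition lall : lincomb B8 := [seq (c1, k) | k <- B8s].

(* co_b o co_a = sum of c co_k over the terms (c, k). *)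
Definition DeltaT (a b : B8) : lincomb B8 :=
  lbind lall (fun k => [seq (t.1, k) | t <- DeltaS k & eq8 t.2.1 a && eq8 t.2.2 b]).

(* The Yetter-Drinfeld compatibility as a rewriting rule:
   co_k o act_e = sum of c act_q o co_j over the terms (c, (q, j)). *)
Definition straight (e k : B8) : lincomb (B8 * B8) :=
  lbind (DeltaS e) (fun mr => lbind (DeltaS mr.1) (fun pq =>
    lbind lall (fun j => lbind (mulS pq.1 j) (fun l =>
      lmap (fun=> (pq.2, j)) [seq t <- mulS l (SB mr.2) | eq8 t.2 k])))).

(** Evaluated once, so that the checks look structure constants up instead of recomputing them. *)
Definition mulTab := Eval vm_compute in memo (fun e => memo (mulS e)).
Definition DeltaTab := Eval vm_compute in memo (fun a => memo (DeltaT a)).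
Definition straightTab :=
  Eval vm_compute in memo (fun e => memo (fun k => norm (straight e k))).

Definition mulL := look2 [::] mulTab.
Definition DeltaL := look2 [::] DeltaTab.
Definition straightL := look2 [::] straightTab.

(* The term (c, (e, k)) stands for c act_e o co_k. *)
Notation drinfeld := (lincomb (B8 * B8)).

Definition Lact (f : B8) (s : drinfeld) : drinfeld :=
  lbind s (fun ek => lmap (fun e => (e, ek.2)) (mulL f ek.1)).
(** For the product of [co_j] with [act_e co_k]: first [co_j] is moved past [act_e], then the two
    adjacent coactions are merged by coassociativity. *)
Definition Lco (j : B8) (s : drinfeld) : drinfeld :=
  lbind s (fun ek => lbind (straightL ek.1 j) (fun qm =>
    lmap (pair qm.1) (DeltaL ek.2 qm.2))).

(** * Matrices with computable entries and the test of the module axioms *)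

Definition cmat := seq (seq cyc).
Definition entry (A : cmat) (j k : nat) : cyc := nth c0 (nth [::] A j) k.
Definition ctab (n : nat) (f : nat -> nat -> cyc) : cmat :=
  mkseq (fun j => mkseq (f j) n) n.
Definition csum (s : seq cyc) : cyc := foldr cadd c0 s.
Definition cmx_mul n (A B : cmat) : cmat :=
  ctab n (fun j k => csum (mkseq (fun l => cmul (entry A j l) (entry B l k)) n)).
Definition cmx_scalar n (c : cyc) : cmat := ctab n (fun j k => if j == k then c else c0).
Definition cmx_lin n (T : Type) (F : T -> cmat) (s : lincomb T) : cmat :=
  foldr (fun t M => ctab n (fun j k => cadd (cmul t.1 (entry (F t.2) j k)) (entry M j k)))
        (cmx_scalar n c0) s.
Definition cmx_eq n (A B : cmat) : bool :=
  all (fun j => all (fun k => ceq (entry A j k) (entry B j k)) (iota 0 n)) (iota 0 n).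

(* Counterpart of [ydmat] with computable coefficients; likewise for the c- and l-prefixed
   copies of the definitions of the 22 modules. *)
Record cmod := CMod {
  cm_n : nat;
  cm_X : nat -> nat -> cyc;
  cm_Y : nat -> nat -> cyc;
  cm_Z : nat -> nat -> cyc;
  cm_h : nat -> nat -> lincomb B8 }.

Definition cact (m : cmod) (e : B8) : cmat :=
  let n := cm_n m in let I := cmx_scalar n c1 in
  cmx_mul n (cmx_mul n (if e.1.1 then ctab n (cm_X m) else I)
                       (if e.1.2 then ctab n (cm_Y m) else I))
            (if e.2 then ctab n (cm_Z m) else I).
Definition cco (m : cmod) (k : B8) : cmat :=
  ctab (cm_n m) (fun l j => coef (cm_h m j l) k).

(** The products [act_e co_k] are tabulated in [AO] because the compatibility test uses each of them
    many times. *)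
Definition check_yd n (As Os : seq cmat) : bool :=
  let act := look [::] As in let co := look [::] Os in
  let AO := memo (fun e => memo (fun k => cmx_mul n (act e) (co k))) in
  let actco (ek : B8 * B8) := look2 [::] AO ek.1 ek.2 in
  [&& cmx_eq n (act unitB) (cmx_scalar n c1),
      all (fun e => all (fun f =>
        cmx_eq n (cmx_mul n (act e) (act f)) (cmx_lin n act (mulL e f))) B8s) B8s,
      cmx_eq n (cmx_lin n co lall) (cmx_scalar n c1),
      all (fun a => all (fun b =>
        cmx_eq n (cmx_mul n (co b) (co a)) (cmx_lin n co (DeltaL a b))) B8s) B8s
    & all (fun e => all (fun k =>
        cmx_eq n (cmx_mul n (co k) (act e)) (cmx_lin n actco (straightL e k))) B8s) B8s].

(** * The 22 modules with computable coefficients *)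

Definition ladd (T : Type) (s t : lincomb T) : lincomb T := s ++ t.
Definition lmul (s t : lincomb B8) : lincomb B8 := lbind s (fun e => lbind t (mulS e)).
Definition lg (g : G4) : lincomb B8 := lret (g, false).
Definition lh1 := lg g1.
Definition lhz : lincomb B8 := lret (g1, true).
Definition csgn (b : bool) : cyc := if b then copp c1 else c1.
Definition lf (j k : bool) : lincomb B8 :=
  lscale (cmul chalf chalf)
    (lmul (ladd lh1 (lscale (csgn j) (lg gx))) (ladd lh1 (lscale (csgn k) (lg gy)))).

Definition cM1 (b : cyc) (g : G4) : cmod :=
  CMod 1 (fun _ _ => cmul b b) (fun _ _ => cmul b b) (fun _ _ => b) (fun _ _ => lg g).
Definition cdiag2 (a b : cyc) (j k : nat) : cyc :=
  if j == k then (if j == 0%N then a else b) else c0.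
Definition canti2 (a b : cyc) (j k : nat) : cyc :=
  if j == k then c0 else (if k == 0%N then a else b).
Definition cmk2 (T : Type) (h11 h12 h21 h22 : T) (j l : nat) : T :=
  if j == 0%N then (if l == 0%N then h11 else h12) else (if l == 0%N then h21 else h22).

Definition cN1 := copp c1.
Definition cM2_1xy : cmod :=
  CMod 2 (cdiag2 cN1 cN1) (cdiag2 cN1 cN1) (canti2 ci ci) (cmk2 lh1 [::] [::] (lg gxy)).
Definition cM2_xy : cmod :=
  CMod 2 (cdiag2 c1 c1) (cdiag2 c1 c1) (canti2 c1 c1) (cmk2 (lg gx) [::] [::] (lg gy)).
Definition cM2_g (ga gb : G4) : cmod :=
  CMod 2 (cdiag2 c1 cN1) (cdiag2 cN1 c1) (canti2 c1 c1) (cmk2 (lg ga) [::] [::] (lg gb)).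
Definition cW_b (b1 b2 : cyc) : cmod :=
  CMod 2 (cdiag2 c1 cN1) (cdiag2 c1 cN1) (cdiag2 b2 (cmul (cmul (copp ci) b1) b2))
    (cmk2 (lmul (ladd (lf false false) (lscale (copp (cmul ci b1)) (lf true true))) lhz)
          (lmul (ladd (lf true false) (lscale (cmul ci b1) (lf false true))) lhz)
          (lmul (ladd (lf true false) (lscale (copp (cmul ci b1)) (lf false true))) lhz)
          (lmul (ladd (lf false false) (lscale (cmul ci b1) (lf true true))) lhz)).

(** This is z^-1 = - z^3, the value of 1 / sqrt(i). *)
Definition czV : cyc := Cyc 0 0 0 (-1) 0.
Definition lw : lincomb B8 :=
  lmul (ladd (ladd (ladd (lf false false) (lscale cz (lf true false)))
    (lscale czV (lf false true))) (lscale ci (lf true true))) lhz.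

Definition cWh : nat -> nat -> lincomb B8 :=
  cmk2 (lscale chalf (lmul (ladd (lg gx) (lg gy)) lw))
       (lscale (cmul cz chalf) (lmul (ladd (lg gx) (lscale cN1 (lg gy))) lw))
       (lscale (cmul cz chalf) (lmul (ladd lh1 (lscale cN1 (lg gxy))) lw))
       (lscale chalf (lmul (ladd lh1 (lg gxy)) lw)).
Definition cWz (a : cyc) : nat -> nat -> cyc :=
  canti2 (cmul (cmul chalf (cadd c1 (copp ci))) (cadd a c1))
         (cmul (cmul chalf (cadd c1 ci)) (cadd a c1)).
Definition cW1 (a : cyc) : cmod := CMod 2 (cdiag2 cN1 c1) (cdiag2 c1 cN1) (cWz a) cWh.
Definition cW2 (a : cyc) : cmod := CMod 2 (cdiag2 c1 cN1) (cdiag2 cN1 c1) (cWz a) cWh.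

Definition csimples : seq cmod :=
  [:: cM1 c1 g1; cM1 cN1 g1; cM1 c1 gxy; cM1 cN1 gxy;
      cM1 ci gx; cM1 (copp ci) gx; cM1 ci gy; cM1 (copp ci) gy;
      cM2_1xy; cM2_xy;
      cM2_g g1 gy; cM2_g gx g1; cM2_g gxy gx; cM2_g gy gxy;
      cW_b c1 c1; cW_b c1 cN1; cW_b cN1 c1; cW_b cN1 cN1;
      cW1 (cadd cN1 cs2); cW1 (cadd cN1 (copp cs2));
      cW2 (cadd cN1 cs2); cW2 (cadd cN1 (copp cs2))].

Definition ctables (m : cmod) : nat * seq cmat * seq cmat :=
  (cm_n m, memo (cact m), memo (cco m)).
Definition simplesTab := Eval vm_compute in map ctables csimples.
Definition tables (n : nat) := nth (0%N, [::], [::]) simplesTab n.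

Definition check_simples : bool :=
  all (fun n => let: (d, As, Os) := tables n in check_yd d As Os) (iota 0 22).

(** * Matrix units of the double *)

Definition tensor (h phi : lincomb B8) : drinfeld :=
  lbind h (fun e => lmap (pair e) phi).

(* The functional on H_8 extracting the coefficient of [f_jk z] in the basis [f_jk z] of
   the span of the [g z]. *)
Definition fz_coef (jk : G4) : lincomb B8 :=
  [seq (cmul (csgn (jk.1 && g.1)) (csgn (jk.2 && g.2)), (g, true))
     | g <- [:: g1; gx; gy; gxy]].
Definition fz_coef2 (c : cyc) (u v : G4) : lincomb B8 :=
  lscale chalf (ladd (fz_coef u) (lscale c (fz_coef v))).

(* [h (1 + c z) / 2], an idempotent if [c] is the inverse of an eigenvalue of [z] on [h]. *)
Definition z_idem (c : cyc) (h : lincomb B8) : lincomb B8 :=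
  lscale chalf (ladd h (lscale c (lmul h lhz))).

(** f_ss selects the vectors on which x and y act by (-1)^s, [z_idem] the eigenvalue of z inverse to
    [bV], and [co_g] the degree g. *)
Definition unit_M1 (s : bool) (bV : cyc) (g : G4) (j k : nat) : drinfeld :=
  tensor (z_idem bV (lf s s)) (lg g).

(** [fa] and [fb] are the idempotents for the characters of x and y on p_1 and p_2, the coaction by
    [ga] or [gb] picks the basis vector, and [c] is the inverse of the entries of z. *)
Definition unit_M2 (c : cyc) (fa fb : lincomb B8) (ga gb : G4) : nat -> nat -> drinfeld :=
  cmk2 (tensor fa (lg ga)) (tensor (lscale c (lmul lhz fb)) (lg gb))
       (tensor (lscale c (lmul lhz fa)) (lg ga)) (tensor fb (lg gb)).

(* Dual basis of the matrix coefficients [c_jk] of [W_b], where [rho p_j] is the sum of the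
   [c_jk (x) p_k]: the functional dual to [c_kj] takes [p_k] to [p_j]. *)
Definition W_b_dual (b1 : cyc) : nat -> nat -> lincomb B8 :=
  let c := cmul ci b1 in
  cmk2 (fz_coef2 c g1 gxy) (fz_coef2 (copp c) gx gy)
       (fz_coef2 c gx gy) (fz_coef2 (copp c) g1 gxy).

Definition unit_W_b (b1 b2 : cyc) (j k : nat) : drinfeld :=
  tensor (if j == 0%N then z_idem b2 (lf false false)
          else z_idem (cmul (cmul ci b1) b2) (lf true true)) (W_b_dual b1 k j).

(* For W_1 and W_2 the matrix coefficients are c_11 = (f_00 - i f_11) z,
   c_12 = (f_01 - i f_10) z, c_21 = (f_01 + i f_10) z and c_22 = (f_00 + i f_11) z. *)
Definition W_a_dual : nat -> nat -> lincomb B8 :=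
  cmk2 (fz_coef2 ci g1 gxy) (lscale ci (fz_coef2 (copp ci) gx gy))
       (lscale (copp ci) (fz_coef2 ci gx gy)) (fz_coef2 (copp ci) g1 gxy).

(* [c] is the inverse of the entry of [z] taking the other basis vector to [w_j]: both
   summands agree on the module with this [a], and cancel on the one with the other [a]. *)
Definition unit_W_a (fa fb : lincomb B8) (ca cb : cyc) (j k : nat) : drinfeld :=
  let f := if j == 0%N then fa else fb in
  let c := if j == 0%N then ca else cb in
  lscale chalf (ladd (tensor f (W_a_dual k j))
    (tensor (lscale c (lmul f lhz)) (W_a_dual k (1 - j)))).

Definition cunits : seq (nat -> nat -> drinfeld) :=
  let f00 := lf false false in let f11 := lf true true in
  let f01 := lf false true in let f10 := lf true false in
  [:: unit_M1 false c1 g1; unit_M1 false cN1 g1; unit_M1 false c1 gxy; unit_M1 false cN1 gxy;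
      unit_M1 true (copp ci) gx; unit_M1 true ci gx; unit_M1 true (copp ci) gy; unit_M1 true ci gy;
      unit_M2 (copp ci) f11 f11 g1 gxy; unit_M2 c1 f00 f00 gx gy;
      unit_M2 c1 f01 f10 g1 gy; unit_M2 c1 f01 f10 gx g1;
      unit_M2 c1 f01 f10 gxy gx; unit_M2 c1 f01 f10 gy gxy;
      unit_W_b c1 c1; unit_W_b c1 cN1; unit_W_b cN1 c1; unit_W_b cN1 cN1;
      unit_W_a f10 f01 czV cz; unit_W_a f10 f01 (copp czV) (copp cz);
      unit_W_a f01 f10 czV cz; unit_W_a f01 f10 (copp czV) (copp cz)].

Definition unitsTab : seq (seq (seq drinfeld)) := Eval vm_compute in
  mkseq (fun n => let d := (tables n).1.1 in
    mkseq (fun j => mkseq (fun k =>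
      norm (nth (fun _ _ => [::]) cunits n j k)) d) d) 22.
Definition units (n j k : nat) : drinfeld :=
  nth [::] (nth [::] (nth [::] unitsTab n) j) k.

(** * The identities decided by evaluation *)

Definition column (L : cmat) (d n k j : nat) : drinfeld :=
  flatten (mkseq (fun l => lscale (entry L l k) (units n l j)) d).

(** For fixed j, p_k |-> E_kj is a morphism from M_n to the double as a left module over itself. *)
Definition check_columns : bool :=
  all (fun n => let: (d, As, Os) := tables n in
    all (fun k => all (fun j => all (fun e =>
      eql (Lact e (units n k j)) (column (look [::] As e) d n k j)
      && eql (Lco e (units n k j)) (column (look [::] Os e) d n k j)) B8s)
    (iota 0 d)) (iota 0 d)) (iota 0 22).

Definition crho (As Os : seq cmat) (d : nat) (s : drinfeld) : cmat :=
  cmx_lin d (fun ek => cmx_mul d (look [::] As ek.1) (look [::] Os ek.2)) s.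

Definition cdelta (d j k : nat) : cmat :=
  ctab d (fun a b => if (a == j) && (b == k) then c1 else c0).

(** Between different blocks the diagonal units are enough: those of block n sum to the identity on
    M_n and to 0 on M_m, which rules out an isomorphism. *)
Definition check_orthogonality : bool :=
  all (fun m => let: (d, As, Os) := tables m in all (fun n =>
    all (fun j => if n == m
      then all (fun k => cmx_eq d (crho As Os d (units n j k)) (cdelta d j k)) (iota 0 d)
      else cmx_eq d (crho As Os d (units n j j)) (cmx_scalar d c0))
    (iota 0 (tables n).1.1)) (iota 0 22)) (iota 0 22).

(** The right side is the unit of the double, since the counit is 1 on every PBW basis element. *)
Definition check_sum : bool :=
  eql (flatten (mkseq (fun n => flatten (mkseq (fun j => units n j j) (tables n).1.1)) 22))
      (lmap (pair unitB) lall).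

Lemma check_simplesT : check_simples. Proof. by vm_compute. Qed.

Lemma check_columnsT : check_columns. Proof. by vm_compute. Qed.

Lemma check_orthogonalityT : check_orthogonality. Proof. by vm_compute. Qed.

Lemma check_sumT : check_sum. Proof. by vm_compute. Qed.

(** * Interpretation in a field with a primitive eighth root of unity *)

Section Semantics.
Variables (K : fieldType) (z : K).
Hypotheses (z4 : z ^+ 4 = -1) (two_neq0 : 2%:R != 0 :> K).

(** * Evaluation of the coefficients *)

Definition evZ (a : Z) : K := (int_of_Z a)%:~R.

Lemma evZD a b : evZ (Z.add a b) = evZ a + evZ b.
Proof. by rewrite /evZ -[Z.add a b]/(a + b) !rmorphD. Qed.
Lemma evZM a b : evZ (Z.mul a b) = evZ a * evZ b.
Proof. by rewrite /evZ -[Z.mul a b]/(a * b) !rmorphM. Qed.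
Lemma evZN a : evZ (Z.opp a) = - evZ a.
Proof. by rewrite /evZ -[Z.opp a]/(- a) !rmorphN. Qed.
Lemma evZB a b : evZ (Z.sub a b) = evZ a - evZ b.
Proof. by rewrite -Z.add_opp_r evZD evZN. Qed.
Lemma evZ0 : evZ 0 = 0. Proof. by []. Qed.
Lemma evZ1 : evZ 1 = 1. Proof. by []. Qed.
Lemma evZ_pow2 n : evZ (pow2 n) = 2%:R ^+ n.
Proof. by elim: n => //= n IHn; rewrite Z.double_spec evZM IHn exprS. Qed.

Definition ev (a : cyc) : K :=
  let: Cyc a0 a1 a2 a3 n := a in
  (evZ a0 + evZ a1 * z + evZ a2 * z ^+ 2 + evZ a3 * z ^+ 3) * Defs.half K ^+ n.

Lemma half2 : Defs.half K * 2%:R = 1. Proof. by rewrite mulVf. Qed.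

Lemma evD a b : ev (cadd a b) = ev a + ev b.
Proof.
case: a b => [a0 a1 a2 a3 m] [b0 b1 b2 b3 n] /=.
rewrite !evZD !evZM !evZ_pow2.
have halfD k l : Defs.half K ^+ (k + l) * 2%:R ^+ l = Defs.half K ^+ k.
  by rewrite exprD -mulrA -exprMn half2 expr1n mulr1.
have /= hm := halfD m (n - m)%N; have /= hn := halfD n (m - n)%N.
rewrite -[in RHS]hm -[in RHS]hn (_ : n + (m - n) = m + (n - m))%N; last by lia.
ring.
Qed.

Lemma evN a : ev (copp a) = - ev a.
Proof. by case: a => *; rewrite /= !evZN; ring. Qed.

Lemma evM a b : ev (cmul a b) = ev a * ev b.
Proof.
case: a b => [a0 a1 a2 a3 m] [b0 b1 b2 b3 n] /=.
rewrite !(evZB, evZD, evZM) exprD.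
apply/eqP; rewrite -subr_eq0; apply/eqP.
(* The reduced product differs from the true one by a multiple of z^4 + 1; the cofactor collects the
   products of degree at least 4. *)
transitivity (- (z ^+ 4 + 1) * Defs.half K ^+ m * Defs.half K ^+ n *
  (evZ a1 * evZ b3 + evZ a2 * evZ b2 + evZ a3 * evZ b1
   + (evZ a2 * evZ b3 + evZ a3 * evZ b2) * z + evZ a3 * evZ b3 * z ^+ 2)); first by ring.
by rewrite z4 addNr oppr0 !mul0r.
Qed.

Lemma ev0 : ev c0 = 0. Proof. by rewrite /= !evZ0; ring. Qed.
Lemma ev1 : ev c1 = 1. Proof. by rewrite /= !evZ0 evZ1; ring. Qed.
Lemma ev_half : ev chalf = Defs.half K. Proof. by rewrite /= !evZ0 evZ1; ring. Qed.

Lemma czeroP a : czero a -> ev a = 0.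
Proof.
case: a => a0 a1 a2 a3 n /and4P[/Z.eqb_spec-> /Z.eqb_spec-> /Z.eqb_spec-> /Z.eqb_spec->].
by rewrite /= !evZ0; ring.
Qed.

Lemma ceqP a b : ceq a b -> ev a = ev b.
Proof. by move=> /czeroP; rewrite evD evN => /eqP; rewrite subr_eq0 => /eqP. Qed.

Arguments ev : simpl never.
Arguments copp : simpl never.
Arguments cadd : simpl never.
Arguments cmul : simpl never.

Lemma eq8E e f : eq8 e f = (e == f).
Proof. by case: e f => [[[] []] []] [[[] []] []]. Qed.

Lemma perm_B8s : perm_eq (index_enum B8) B8s.
Proof.
apply: uniq_perm; rewrite ?index_enum_uniq //.
by move=> [[[] []] []]; rewrite mem_index_enum.
Qed.

Lemma mem_B8s e : e \in B8s. Proof. by rewrite -(perm_mem perm_B8s) mem_index_enum. Qed.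

Lemma big_B8 (V : nmodType) (F : B8 -> V) : \sum_(e : B8) F e = \sum_(e <- B8s) F e.
Proof. exact: perm_big perm_B8s. Qed.

Lemma all_B8sP (P : pred B8) : all P B8s -> forall e, P e.
Proof. by move/allP=> h e; apply/h/mem_B8s. Qed.

(** * Evaluation of formal linear combinations *)

Section Lin.
Variable V : lmodType K.

Definition lin (T : Type) (F : T -> V) (s : lincomb T) : V :=
  \sum_(t <- s) ev t.1 *: F t.2.

Lemma eq_lin (T : Type) (F G : T -> V) s : F =1 G -> lin F s = lin G s.
Proof. by move=> eqFG; apply: eq_bigr => t _; rewrite eqFG. Qed.

Lemma lin_nil (T : Type) (F : T -> V) : lin F [::] = 0.
Proof. exact: big_nil. Qed.

Lemma lin_cons (T : Type) (F : T -> V) t s : lin F (t :: s) = ev t.1 *: F t.2 + lin F s.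
Proof. exact: big_cons. Qed.

Lemma lin_ret (T : Type) (F : T -> V) t : lin F (lret t) = F t.
Proof. by rewrite lin_cons lin_nil ev1 scale1r addr0. Qed.

Lemma lin_cat (T : Type) (F : T -> V) s t : lin F (s ++ t) = lin F s + lin F t.
Proof. exact: big_cat. Qed.

Lemma lin_scale (T : Type) (F : T -> V) c s : lin F (lscale c s) = ev c *: lin F s.
Proof.
by rewrite /lin big_map scaler_sumr; apply: eq_bigr => t _; rewrite scalerA -evM.
Qed.

Lemma lin_map (T U : Type) (F : U -> V) (g : T -> U) s :
  lin F (lmap g s) = lin (fun t => F (g t)) s.
Proof. exact: big_map. Qed.

Lemma lin_flatten (T : Type) (F : T -> V) ss : lin F (flatten ss) = \sum_(s <- ss) lin F s.
Proof. exact: big_flatten. Qed.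

Lemma lin_bind (T U : Type) (F : U -> V) (G : T -> lincomb U) s :
  lin F (lbind s G) = lin (fun t => lin F (G t)) s.
Proof. by rewrite lin_flatten big_map; apply: eq_bigr => t _; rewrite lin_scale. Qed.

Lemma lin_all (F : B8 -> V) : lin F lall = \sum_(e : B8) F e.
Proof. by rewrite big_B8 /lin big_map; apply: eq_bigr => e _; rewrite ev1 scale1r. Qed.

(** Passes from coefficient functions summed over a whole finite type, as in the axioms, to sparse
    lists with possible repetitions. *)
Lemma lin_finType (T : finType) (F : T -> V) s (w : T -> K) :
  (forall x, w x = \sum_(t <- s | t.2 == x) ev t.1) ->
  \sum_x w x *: F x = lin F s.
Proof.
move=> wE; rewrite /lin (eq_bigr (fun x => \sum_(t <- s | t.2 == x) ev t.1 *: F t.2)).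
  rewrite (exchange_big_dep xpredT) //=; apply: eq_bigr => t _.
  by rewrite (eq_bigl (pred1 t.2)) ?big_pred1_eq // => x; rewrite eq_sym.
by move=> x _; rewrite wE scaler_suml; apply: eq_bigr => t /eqP->.
Qed.

End Lin.

Lemma ev_coef s k : ev (coef s k) = \sum_(t <- s | t.2 == k) ev t.1.
Proof.
elim: s => [|t s IHs] /=; first by rewrite big_nil ev0.
by rewrite big_cons eq8E; case: eqP => _; rewrite ?evD IHs.
Qed.

Lemma lin_coef (V : lmodType K) (F : B8 -> V) s : lin F s = \sum_k ev (coef s k) *: F k.
Proof. by apply/esym/lin_finType => k; rewrite ev_coef. Qed.

Lemma eql8P (V : lmodType K) (F : B8 -> V) s t : eql8 s t -> lin F s = lin F t.
Proof.
by move/all_B8sP=> est; rewrite !lin_coef; apply: eq_bigr => k _; rewrite (ceqP (est k)).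
Qed.

Lemma lin_norm8 (V : lmodType K) (F : B8 -> V) s : lin F (norm8 s) = lin F s.
Proof.
rewrite [RHS]lin_coef big_B8 /lin /norm8 big_map big_filter /=.
rewrite [RHS](bigID (fun k => czero (coef s k))) /=.
rewrite [X in X + _]big1 ?add0r // => k /czeroP->; exact: scale0r.
Qed.

Lemma lin_slice (V : lmodType K) (F : B8 * B8 -> V) s :
  lin F s = \sum_e lin (fun k => F (e, k)) (slice s e).
Proof.
rewrite (eq_bigr (fun e => \sum_(t <- s | t.2.1 == e) ev t.1 *: F t.2)) => [|e _]; last first.
  rewrite /lin big_map big_filter /=; apply: eq_big => [t|t /=]; first by rewrite eq8E.
  by rewrite eq8E => /eqP <-; case: t => c [].
rewrite (exchange_big_dep xpredT) //=; apply: eq_bigr => t _.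
by rewrite (eq_bigl (pred1 t.2.1)) ?big_pred1_eq // => x; rewrite eq_sym.
Qed.

Lemma eqlP (V : lmodType K) (F : B8 * B8 -> V) s t : eql s t -> lin F s = lin F t.
Proof.
move/all_B8sP=> est; rewrite !lin_slice; apply: eq_bigr => e _; exact: eql8P (est e).
Qed.

Lemma lin_norm (V : lmodType K) (F : B8 * B8 -> V) s : lin F (norm s) = lin F s.
Proof.
rewrite lin_flatten big_map [RHS]lin_slice big_B8; apply: eq_bigr => e _.
by rewrite lin_map lin_norm8.
Qed.

Lemma look_memo (A : Type) (x0 : A) (f : B8 -> A) e : look x0 (memo f) e = f e.
Proof. by case: e => [[[] []] []]. Qed.

Lemma mulLE e f : mulL e f = mulS e f.
Proof. by case: e f => [[[] []] []] [[[] []] []]. Qed.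

Lemma DeltaLE a b : DeltaL a b = DeltaT a b.
Proof.
(* Turns the right side into a lookup in a closed table, which evaluation can compare with
   [DeltaTab] while [a] and [b] stay variables. *)
rewrite -[RHS](look_memo [::] (fun b => DeltaT a b)).
by rewrite -[memo _ in RHS](look_memo [::] (fun a => memo (DeltaT a))); vm_compute.
Qed.

Lemma straightLE e k : straightL e k = norm (straight e k).
Proof.
rewrite -[RHS](look_memo [::] (fun k => norm (straight e k))).
rewrite -[memo _ in RHS](look_memo [::] (fun e => memo (fun k => norm (straight e k)))).
by rewrite /straightL /look2; congr (look _ (look _ _ _) _); vm_compute.
Qed.

(** * Agreement of the lists with the structure maps of H_8 *)

Lemma ebE (e k : B8) : eb K e k = (e == k)%:R.
Proof. by rewrite ffunE eq_sym. Qed.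

Lemma lin_eb s k : (lin (eb K) s) k = ev (coef s k).
Proof.
rewrite ev_coef /lin sum_ffunE [RHS]big_mkcond; apply: eq_bigr => t _.
by rewrite ffunE ebE; case: eqP => _; [apply: mulr1 | apply: mulr0].
Qed.

Lemma mulBE e f : mulB K e f = lin (eb K) (mulS e f).
Proof.
rewrite /mulB /mulS; case: ifP => _; rewrite !lin_cons lin_nil.
  by rewrite /= evN ev_half scaleNr addr0 scalerBr !scalerDr !addrA.
by rewrite ev1 scale1r addr0.
Qed.

Lemma lin_eb_sum (V : lmodType K) (F : B8 -> V) s :
  \sum_k (lin (eb K) s) k *: F k = lin F s.
Proof. by apply: lin_finType => k; rewrite lin_eb ev_coef. Qed.

Lemma lin_eb_scale (V : lmodType K) (w : V) s k :
  (lin (eb K) s) k *: w = lin (fun l => eb K l k *: w) s.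
Proof.
rewrite lin_eb ev_coef scaler_suml big_mkcond; apply: eq_bigr => t _.
by rewrite ebE; case: ifP => _; rewrite ?scale1r // scale0r scaler0.
Qed.

Lemma lin_filter (V : lmodType K) (F : B8 -> V) s k :
  lin F [seq t <- s | eq8 t.2 k] = lin (fun l => eb K l k *: F l) s.
Proof.
rewrite /lin big_filter big_mkcond; apply: eq_bigr => t _.
by rewrite eq8E ebE; case: ifP => _; rewrite ?scale1r // scale0r scaler0.
Qed.

Lemma mulHE s t : mulH (lin (eb K) s) (lin (eb K) t) = lin (eb K) (lmul s t).
Proof.
rewrite /mulH /lmul lin_bind -[RHS]lin_eb_sum; apply: eq_bigr => e _.
rewrite lin_bind -(lin_eb_sum (fun f => lin (eb K) (mulS e f))) scaler_sumr.
by apply: eq_bigr => f _; rewrite scalerA mulBE.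
Qed.

Lemma actH_mulB (V : lmodType K) (D : ydstr V) e f v :
  actH D (mulB K e f) v = lin (fun k => yd_act D k v) (mulL e f).
Proof. by rewrite /actH mulBE mulLE lin_eb_sum. Qed.

Lemma DeltaBE e p q :
  DeltaB K e p q = \sum_(t <- DeltaS e | t.2 == (p, q)) ev t.1.
Proof.
rewrite /DeltaB /DeltaS; case: e => g c /=.
case: c; rewrite unlock /= -!pair_eqE /= ![_ == p]eq_sym ![_ == q]eq_sym.
  have ifE (b : bool) (x y : K) : (if b then x + y else y) = b%:R * x + y.
    by case: b; rewrite ?mul1r // mul0r add0r.
  by rewrite !ifE evN ev_half; ring.
by case: ifP; rewrite ?ev1 ?addr0.
Qed.

Lemma sum_DeltaB2 (V : lmodType K) (G : B8 -> B8 -> V) e :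
  \sum_p \sum_q DeltaB K e p q *: G p q = lin (fun u => G u.1 u.2) (DeltaS e).
Proof. by rewrite pair_big /=; apply: lin_finType => -[p q]; rewrite DeltaBE. Qed.

Lemma sum_DeltaB (V : lmodType K) (G : B8 -> V) a b :
  \sum_k DeltaB K k a b *: G k = lin G (DeltaL a b).
Proof.
rewrite DeltaLE lin_bind lin_all; apply: eq_bigr => k _.
rewrite DeltaBE /lin big_map big_filter /= scaler_suml.
by apply: eq_bigl => -[c [p q]]; rewrite !eq8E.
Qed.

Lemma sum_Delta2 (V : lmodType K) (G : B8 -> B8 -> B8 -> V) e :
  \sum_p \sum_q \sum_r Delta2 K e p q r *: G p q r =
  lin (fun mr => lin (fun pq => G pq.1 pq.2 mr.2) (DeltaS mr.1)) (DeltaS e).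
Proof.
transitivity (\sum_p \sum_q \sum_r \sum_m (DeltaB K e m r * DeltaB K m p q) *: G p q r).
  by do 3![apply: eq_bigr => ? _]; rewrite scaler_suml.
(* The intermediate index m is moved outside, so that (m, r) runs over Delta(e) and (p, q) over
   Delta(m). *)
under eq_bigr => p _ do [under eq_bigr => q _ do rewrite exchange_big; rewrite exchange_big].
rewrite exchange_big -(sum_DeltaB2 (fun m r => lin (fun pq => G pq.1 pq.2 r) (DeltaS m))).
apply: eq_bigr => m _ /=; under eq_bigr => p _ do rewrite exchange_big.
rewrite exchange_big; apply: eq_bigr => r _ /=.
rewrite -(sum_DeltaB2 (fun p q => G p q r)) scaler_sumr; apply: eq_bigr => p _.
by rewrite scaler_sumr; apply: eq_bigr => q _; rewrite scalerA.
Qed.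

(** Identifies the right side of the Yetter-Drinfeld compatibility with the tabulated rewriting
    rule. *)
Lemma sum_straight (V : lmodType K) (G : B8 -> B8 -> V) e k :
  \sum_p \sum_q \sum_r \sum_j
     (Delta2 K e p q r * mulH (mulH (eb K p) (eb K j)) (eb K (SB r)) k) *: G q j
  = lin (fun qj => G qj.1 qj.2) (straightL e k).
Proof.
rewrite straightLE lin_norm lin_bind.
transitivity (\sum_p \sum_q \sum_r Delta2 K e p q r *:
   \sum_j mulH (mulH (eb K p) (eb K j)) (eb K (SB r)) k *: G q j).
  do 3![apply: eq_bigr => ? _]; rewrite scaler_sumr.
  by apply: eq_bigr => j _; rewrite scalerA.
rewrite sum_Delta2; apply: eq_lin => -[m r] /=; rewrite lin_bind.
apply: eq_lin => -[p q] /=; rewrite lin_bind lin_all; apply: eq_bigr => j _.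
rewrite -!(lin_ret (eb K)) !mulHE lin_eb_scale /lmul.
rewrite !lin_bind lin_ret lin_bind lin_ret.
by apply: eq_lin => l; rewrite lin_bind lin_ret lin_map lin_filter.
Qed.

Lemma linear_at0 (V V' : lmodType K) (f : V -> V') : linear f -> f 0 = 0.
Proof. by move=> lf; have := lf (-1) 0 0; rewrite scaler0 addr0 scaleN1r addNr. Qed.

Lemma linear_lin (V V' : lmodType K) (f : V -> V') (T : Type) (F : T -> V) s :
  linear f -> f (lin F s) = lin (fun t => f (F t)) s.
Proof.
move=> lf; elim: s => [|t s IHs]; first by rewrite !lin_nil linear_at0.
by rewrite !lin_cons lf IHs.
Qed.

Lemma lin_mkseq (V : lmodType K) (T : Type) (F : T -> V) (g : nat -> lincomb T) n :
  lin F (flatten (mkseq g n)) = \sum_(l < n) lin F (g l).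
Proof.
rewrite lin_flatten big_map -(big_mkord xpredT (fun l => lin F (g l))).
by rewrite /index_iota subn0.
Qed.

(** * Action of the double on a Yetter-Drinfeld module *)

Section Operators.
Variables (V : lmodType K) (D : ydstr V).
Hypothesis ydD : is_yd D.

Lemma yd_act_linear e : linear (yd_act D e). Proof. by case: ydD. Qed.
Lemma yd_co_linear k : linear (yd_co D k). Proof. by case: ydD => _ []. Qed.

Lemma yd_actM e f v : yd_act D e (yd_act D f v) = lin (fun k => yd_act D k v) (mulL e f).
Proof. by case: ydD => _ [_ [_ [-> _]]]; apply: actH_mulB. Qed.

Lemma yd_coM a b v : yd_co D b (yd_co D a v) = lin (fun k => yd_co D k v) (DeltaL a b).
Proof. by case: ydD => _ [_ [_ [_ [_ [-> _]]]]]; rewrite sum_DeltaB. Qed.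

Lemma yd_co_act e k v :
  yd_co D k (yd_act D e v) =
  lin (fun qj => yd_act D qj.1 (yd_co D qj.2 v)) (straightL e k).
Proof.
case: ydD => _ [_ [_ [_ [_ [_ ->]]]]].
exact: (sum_straight (fun q j => yd_act D q (yd_co D j v))).
Qed.

Definition op (s : drinfeld) (v : V) : V :=
  lin (fun ek => yd_act D ek.1 (yd_co D ek.2 v)) s.

(** With [co_op], this makes every identity checked on lists hold as an identity of operators on
    V. *)
Lemma act_op e s v : yd_act D e (op s v) = op (Lact e s) v.
Proof.
rewrite /op linear_lin; last exact: yd_act_linear.
rewrite lin_bind; apply: eq_lin => -[f k] /=.
by rewrite lin_map yd_actM.
Qed.

Lemma co_op j s v : yd_co D j (op s v) = op (Lco j s) v.
Proof.
rewrite /op linear_lin; last exact: yd_co_linear.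
rewrite lin_bind; apply: eq_lin => -[e k] /=.
rewrite lin_bind yd_co_act; apply: eq_lin => -[q m] /=.
by rewrite lin_map yd_coM linear_lin //; apply: yd_act_linear.
Qed.

Lemma op_one v : op (lmap (pair unitB) lall) v = v.
Proof.
case: ydD => _ [_ [act1 [_ [counit _]]]].
rewrite /op lin_map lin_all -[RHS]counit; apply: eq_bigr => k _ /=.
by rewrite act1 scale1r.
Qed.

Lemma subyd_op (W : V -> Prop) s v : is_subyd D W -> W v -> W (op s v).
Proof.
case=> W0 WD Wact Wco Wv; elim: s => [|t s IHs]; first by rewrite /op lin_nil.
by rewrite /op lin_cons; apply: WD => //; apply/Wact/Wco.
Qed.

End Operators.

Lemma op_morph (V V' : lmodType K) (D : ydstr V) (D' : ydstr V') (f : V -> V') s v :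
  linear f -> (forall e v, f (yd_act D e v) = yd_act D' e (f v)) ->
  (forall k v, f (yd_co D k v) = yd_co D' k (f v)) -> f (op D s v) = op D' s (f v).
Proof.
by move=> lf fact fco; rewrite /op linear_lin //; apply: eq_lin => ek; rewrite fact fco.
Qed.

(** * Matrices over K and the models that the tables describe *)

Definition repmx (n : nat) (A : 'M[K]_n) (a : cmat) : Prop :=
  forall j k : 'I_n, A j k = ev (entry a j k).

Lemma entry_ctab n (f : nat -> nat -> cyc) (j k : 'I_n) : entry (ctab n f) j k = f j k.
Proof. by rewrite /entry !nth_mkseq. Qed.

Lemma repmx_tab n (A : 'M[K]_n) (f : nat -> nat -> cyc) :
  (forall j k : 'I_n, A j k = ev (f j k)) -> repmx A (ctab n f).
Proof. by move=> h j k; rewrite entry_ctab. Qed.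

Lemma ev_csum n (f : nat -> cyc) : ev (csum (mkseq f n)) = \sum_(l < n) ev (f l).
Proof.
rewrite -(big_mkord xpredT (fun l => ev (f l))) /index_iota subn0 -(big_map f xpredT ev).
rewrite -/(mkseq f n); elim: (mkseq f n) => [|a s IHs]; first by rewrite big_nil ev0.
by rewrite big_cons evD IHs.
Qed.

Lemma repmx_mul n (A B : 'M[K]_n) a b :
  repmx A a -> repmx B b -> repmx (A *m B) (cmx_mul n a b).
Proof.
move=> Aa Bb; apply: repmx_tab => j k; rewrite mxE ev_csum.
by apply: eq_bigr => l _; rewrite evM Aa Bb.
Qed.

Lemma repmx_scalar n c : @repmx n (ev c)%:M (cmx_scalar n c).
Proof. by apply: repmx_tab => j k; rewrite mxE -val_eqE; case: ifP; rewrite ?ev0. Qed.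

Lemma repmx1 n : @repmx n 1%:M (cmx_scalar n c1).
Proof. by rewrite -ev1; apply: repmx_scalar. Qed.

Lemma repmx0 n : @repmx n 0 (cmx_scalar n c0).
Proof. by move=> j k; rewrite -repmx_scalar ev0 !mxE mul0rn. Qed.

Lemma repmx_lin n (T : Type) (A : T -> 'M[K]_n) a s :
  (forall t, repmx (A t) (a t)) -> repmx (lin A s) (cmx_lin n a s).
Proof.
move=> Aa; elim: s => [|t s IHs]; first by rewrite lin_nil; apply: repmx0.
by rewrite lin_cons; apply: repmx_tab => j k; rewrite !mxE evD evM Aa IHs.
Qed.

Lemma mem_iota_ord d (j : 'I_d) : val j \in iota 0 d.
Proof. by rewrite mem_iota ltn_ord. Qed.

Lemma repmx_eq n (A B : 'M[K]_n) a b : repmx A a -> repmx B b -> cmx_eq n a b -> A = B.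
Proof.
move=> Aa Bb /allP ab; apply/matrixP => j k; rewrite Aa Bb; apply: ceqP.
by have /allP := ab _ (mem_iota_ord j); apply; apply: mem_iota_ord.
Qed.

Lemma repmx_delta n (j k : 'I_n) : repmx (delta_mx j k) (cdelta n j k).
Proof. by apply: repmx_tab => a b; rewrite mxE -!val_eqE; case: ifP; rewrite ?ev0 ?ev1. Qed.

Lemma lin_mulmx n (T : Type) (A : T -> 'M[K]_n) s (v : 'cV[K]_n) :
  lin (fun t => A t *m v) s = lin A s *m v.
Proof. by rewrite /lin mulmx_suml; apply: eq_bigr => t _; rewrite scalemxAl. Qed.

Definition represents (M : ydmat K) (m : cmod) : Prop :=
  [/\ ydm_n M = cm_n m,
      (forall j k : 'I_(ydm_n M), ydm_X M j k = ev (cm_X m j k)),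
      (forall j k : 'I_(ydm_n M), ydm_Y M j k = ev (cm_Y m j k)),
      (forall j k : 'I_(ydm_n M), ydm_Z M j k = ev (cm_Z m j k))
    & (forall j k : 'I_(ydm_n M), ydm_h j k = lin (eb K) (cm_h m j k))].

Section Models.
Variables (M : ydmat K) (m : cmod).
Hypothesis Mm : represents M m.

Lemma dim_represents : ydm_n M = cm_n m. Proof. by case: Mm. Qed.

Lemma repmx_act e : repmx (ydm_act M e) (cact m e).
Proof.
case: Mm => eq_n hX hY hZ _; rewrite /ydm_act /cact -eq_n.
by do 2?apply: repmx_mul; case: ifP => _; [exact: repmx_tab | exact: repmx1
  | exact: repmx_tab | exact: repmx1 | exact: repmx_tab | exact: repmx1].
Qed.

Lemma repmx_co k : repmx (ydm_co M k) (cco m k).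
Proof.
case: Mm => eq_n _ _ _ hh; rewrite /cco -eq_n.
by apply: repmx_tab => l j; rewrite mxE hh lin_eb.
Qed.

Definition rho (s : drinfeld) : 'M[K]_(ydm_n M) :=
  lin (fun ek => ydm_act M ek.1 *m ydm_co M ek.2) s.

Lemma op_model s v : op (model M) s v = rho s *m v.
Proof. by rewrite /rho -lin_mulmx; apply: eq_lin => ek /=; rewrite mulmxA. Qed.

Lemma repmx_rho s : repmx (rho s) (crho (memo (cact m)) (memo (cco m)) (ydm_n M) s).
Proof.
apply: repmx_lin => ek; rewrite !look_memo.
by apply: repmx_mul; [apply: repmx_act | apply: repmx_co].
Qed.

Lemma is_yd_model : check_yd (cm_n m) (memo (cact m)) (memo (cco m)) -> is_yd (model M).
Proof.
rewrite -dim_represents; case/and5P => act1 /all_B8sP actM counit /all_B8sP coM /all_B8sP coact.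
have ra := repmx_act; have rc := repmx_co.
(* The axioms on products of operators share one shape: a matrix equals a linear combination of
   matrices, as certified by [cmx_eq]. *)
have lE (T : Type) (A : T -> 'M_(ydm_n M)) a b s B (v : 'cV_(ydm_n M)) :
    (forall t, repmx (A t) (a t)) ->
    repmx B b -> cmx_eq (ydm_n M) b (cmx_lin (ydm_n M) a s) ->
    B *m v = lin (fun t => A t *m v) s.
  by move=> Aa Bb eq_b; rewrite lin_mulmx (repmx_eq Bb (repmx_lin _ Aa) eq_b).
split; first by move=> e a u v /=; rewrite mulmxDr scalemxAr.
split; first by move=> e a u v /=; rewrite mulmxDr scalemxAr.
split.
  move=> v /=; rewrite look_memo in act1.
  by rewrite (repmx_eq (ra _) (@repmx1 _) act1) mul1mx.
split.
  move=> e f v; rewrite actH_mulB /= mulmxA.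
  have /all_B8sP/(_ f) := actM e; rewrite !look_memo; apply: lE.
    by move=> k; rewrite look_memo.
  exact: repmx_mul.
split.
  have co1 : lin (ydm_co M) lall = 1%:M.
    by apply: repmx_eq (repmx_lin _ _) (@repmx1 _) counit => k; rewrite look_memo.
  move=> v; rewrite -[RHS]mul1mx -co1.
  by rewrite -lin_mulmx lin_all; apply: eq_bigr => k _; rewrite scale1r.
split.
  move=> a b v; rewrite sum_DeltaB /= mulmxA.
  have /all_B8sP/(_ b) := coM a; rewrite !look_memo; apply: lE.
    by move=> k; rewrite look_memo.
  exact: repmx_mul.
move=> e k v; rewrite (sum_straight (fun q j => yd_act (model M) q (yd_co (model M) j v))).
rewrite /= mulmxA.
have /all_B8sP/(_ k) := coact e; rewrite !look_memo.
move=> /(lE _ (fun qj => ydm_act M qj.1 *m ydm_co M qj.2)) ->; first last.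
- exact: repmx_mul.
- move=> t; rewrite /look2 !look_memo; apply: repmx_mul; [exact: ra | exact: rc].
by apply: eq_lin => t; rewrite mulmxA.
Qed.

End Models.
Arguments lmul : simpl never.
Arguments ladd : simpl never.
Arguments lscale : simpl never.
Arguments lf : simpl never.
Arguments lg : simpl never.
Arguments lw : simpl never.
Arguments cWh : simpl never.

(** * The listed modules and the classification *)

Lemma evci : ev ci = z ^+ 2. Proof. by rewrite /ev /= !evZ0 evZ1; ring. Qed.
Lemma evcz : ev cz = z. Proof. by rewrite /ev /= !evZ0 evZ1; ring. Qed.
Lemma evcs2 : ev cs2 = z - z ^+ 3.
Proof. by rewrite /ev /= !evZ0 evZ1 -[Zneg 1]/(Z.opp 1) evZN evZ1; ring. Qed.
Lemma evcN1 : ev cN1 = -1. Proof. by rewrite evN ev1. Qed.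
Lemma evczV : ev czV = z^-1.
Proof.
have z3 : z * - z ^+ 3 = 1 by rewrite mulrN -exprS z4 opprK.
have z_neq0 : z != 0.
  by apply: contra_eq_neq z3 => ->; rewrite mul0r eq_sym oner_eq0.
apply: (mulfI z_neq0); rewrite mulfV // -z3; congr (z * _).
by rewrite /ev /= !evZ0 -[Zneg 1]/(Z.opp 1) evZN evZ1; ring.
Qed.

Lemma hgE g : hg K g = lin (eb K) (lg g). Proof. by rewrite lin_ret. Qed.
Lemma hzE : hz K = lin (eb K) lhz. Proof. by rewrite lin_ret. Qed.

Lemma fjkE j k : fjk K j k = lin (eb K) (lf j k).
Proof.
rewrite /lf lin_scale -mulHE !lin_cat !lin_scale -!hgE evM ev_half /fjk.
have csgnE b : ev (csgn b) = (-1) ^+ b by case: b; rewrite ?evcN1 ?ev1.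
by rewrite !csgnE /Defs.half -invfM -natrM.
Qed.

Definition linE := (=^~ mulHE, lin_cat, lin_scale, =^~ hgE, =^~ hzE, =^~ fjkE,
  evN, evM, evD, ev1, ev_half, evci, evcz, evczV, evcs2, evcN1).

Lemma diag2E a b a' b' (j k : 'I_2) :
  a = ev a' -> b = ev b' -> diag2 a b j k = ev (cdiag2 a' b' j k).
Proof. by move=> -> ->; rewrite mxE /cdiag2 -!val_eqE; do 2?case: ifP; rewrite ?ev0. Qed.

Lemma anti2E a b a' b' (j k : 'I_2) :
  a = ev a' -> b = ev b' -> anti2 a b j k = ev (canti2 a' b' j k).
Proof. by move=> -> ->; rewrite mxE /canti2 -!val_eqE; do 2?case: ifP; rewrite ?ev0. Qed.

Lemma mk2E h11 h12 h21 h22 l11 l12 l21 l22 (j k : 'I_2) :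
  h11 = lin (eb K) l11 -> h12 = lin (eb K) l12 ->
  h21 = lin (eb K) l21 -> h22 = lin (eb K) l22 ->
  mk2 h11 h12 h21 h22 j k = lin (eb K) (cmk2 l11 l12 l21 l22 j k).
Proof. by move=> -> -> -> ->; rewrite /mk2 /cmk2 -!val_eqE; do 2?case: ifP. Qed.

Lemma represents_M1 b b' g : b = ev b' -> represents (M1 b g) (cM1 b' g).
Proof.
by move=> ->; split=> //= j k; rewrite ?hgE // !ord1 mxE mulr1n ?evM.
Qed.

Lemma represents_M2_1xy : represents (M2_1xy (z ^+ 2)) cM2_1xy.
Proof.
split=> //= j k; try (by apply: diag2E; rewrite evcN1); first by apply: anti2E; rewrite evci.
by apply: mk2E; rewrite ?lin_nil // -hgE.
Qed.

Lemma represents_M2_xy : represents (M2_xy K) cM2_xy.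
Proof.
split=> //= j k; try (by apply: diag2E; rewrite ev1); first by apply: anti2E; rewrite ev1.
by apply: mk2E; rewrite ?lin_nil // -hgE.
Qed.

Lemma represents_M2_g ga gb : represents (M2_g K ga gb) (cM2_g ga gb).
Proof.
split=> //= j k; try (by apply: diag2E; rewrite ?evcN1 ?ev1); first by apply: anti2E; rewrite ev1.
by apply: mk2E; rewrite ?lin_nil // -hgE.
Qed.

Lemma represents_W_b b1 b2 b1' b2' :
  b1 = ev b1' -> b2 = ev b2' -> represents (W_b (z ^+ 2) b1 b2) (cW_b b1' b2').
Proof.
move=> -> ->; split=> //= j k; try (by apply: diag2E; rewrite ?evcN1 ?ev1 ?linE).
by apply: mk2E; rewrite !linE ?scaleNr.
Qed.

Lemma hwE : hw (z ^+ 2) z = lin (eb K) lw.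
Proof. by rewrite /lw !linE. Qed.

Lemma WhE (j k : 'I_2) : Wh (z ^+ 2) z j k = lin (eb K) (cWh j k).
Proof. by apply: mk2E; rewrite !linE -?hwE ?scaleN1r. Qed.

Lemma WzE a a' (j k : 'I_2) : a = ev a' -> Wz (z ^+ 2) a j k = ev (cWz a' j k).
Proof. by move=> ->; apply: anti2E; rewrite !linE. Qed.

Lemma represents_W1 a a' : a = ev a' -> represents (W1 (z ^+ 2) z a) (cW1 a').
Proof.
move=> aa'; split=> //= j k; try (by apply: diag2E; rewrite ?evcN1 ?ev1); first exact: WzE.
exact: WhE.
Qed.

Lemma represents_W2 a a' : a = ev a' -> represents (W2 (z ^+ 2) z a) (cW2 a').
Proof.
move=> aa'; split=> //= j k; try (by apply: diag2E; rewrite ?evcN1 ?ev1); first exact: WzE.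
exact: WhE.
Qed.

(** z serves as sqrt(i), so i = z^2, and z - z^3 = z + z^-1 is one of the two square roots of 2. *)
Local Notation model_of := (simples (z ^+ 2) (z - z ^+ 3) z).
Definition csimple (n : nat) : cmod := nth (cM1 c1 g1) csimples n.

Lemma represents_simples (n : 'I_22) : represents (model_of n) (csimple n).
Proof.
case: n => n; rewrite /simples /csimple /=.
do 8![case: n => [_|n]; first by apply: represents_M1; rewrite ?linE].
case: n => [_|n]; first exact: represents_M2_1xy.
case: n => [_|n]; first exact: represents_M2_xy.
do 4![case: n => [_|n]; first exact: represents_M2_g].
do 4![case: n => [_|n]; first by apply: represents_W_b; rewrite ?linE].
do 2![case: n => [_|n]; first by apply: represents_W1; rewrite !linE].
do 2![case: n => [_|n]; first by apply: represents_W2; rewrite !linE].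
by [].
Qed.

Lemma tablesE (n : 'I_22) : tables n = ctables (csimple n).
Proof.
have -> : tables n = nth (0%N, [::], [::]) (map ctables csimples) n by case: n; vm_compute.
by rewrite (nth_map (cM1 c1 g1)) ?size_map //; case: n.
Qed.

Lemma dim_model n : ydm_n (model_of n) = (tables n).1.1.
Proof. by rewrite (dim_represents (represents_simples n)) tablesE. Qed.

Lemma is_yd_simple n : is_yd (model (model_of n)).
Proof.
apply: is_yd_model (represents_simples n) _.
have /allP/(_ _ (mem_iota_ord n)) := check_simplesT.
by rewrite tablesE.
Qed.

(** * Matrix units on the listed modules: simplicity and non-isomorphism *)

Lemma rho_units n (j k : 'I_(ydm_n (model_of n))) :
  rho (model_of n) (units n j k) = delta_mx j k.
Proof.
have /allP/(_ _ (mem_iota_ord n)) := check_orthogonalityT.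
have [dn rhoP] := (dim_model n, repmx_rho (represents_simples n)).
rewrite (surjective_pairing (tables n)) (surjective_pairing (tables n).1) -dn.
move/allP/(_ _ (mem_iota_ord n)); rewrite eqxx -dn.
move/allP/(_ _ (mem_iota_ord j))/allP/(_ _ (mem_iota_ord k)).
rewrite tablesE; apply: repmx_eq (rhoP _) (repmx_delta _ _).
Qed.

Lemma rho_units0 n m (j : 'I_(ydm_n (model_of n))) :
  n != m -> rho (model_of m) (units n j j) = 0.
Proof.
move=> neq_nm; have /allP/(_ _ (mem_iota_ord m)) := check_orthogonalityT.
have [dm rhoP] := (dim_model m, repmx_rho (represents_simples m)).
rewrite (surjective_pairing (tables m)) (surjective_pairing (tables m).1) -dm.
move/allP/(_ _ (mem_iota_ord n)).
have -> : (n == m :> nat) = false by apply: negbTE.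
rewrite -(dim_model n) => /allP/(_ _ (mem_iota_ord j)).
by rewrite tablesE; apply: repmx_eq (rhoP _) (@repmx0 _).
Qed.

Lemma rho_units_sum n :
  \sum_(j < ydm_n (model_of n)) rho (model_of n) (units n j j) = 1%:M.
Proof.
rewrite [RHS]matrix_sum_delta; apply: eq_bigr => j _; rewrite rho_units (bigD1 j) //=.
rewrite mxE eqxx scale1r big1 ?addr0 // => k /negbTE kj.
by rewrite mxE eq_sym kj scale0r.
Qed.

Lemma model_gt0 n : (0 < ydm_n (model_of n))%N.
Proof.
rewrite dim_model; have /allP/(_ _ (mem_iota_ord n)) // :
  all (fun n => 0 < (tables n).1.1)%N (iota 0 22) by vm_compute.
Qed.

Lemma simple_model n : simple_yd (model (model_of n)).
Proof.
split; first exact: is_yd_simple.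
  exists (const_mx 1) => /colP/(_ (Ordinal (model_gt0 n)))/eqP.
  by rewrite !mxE oner_eq0.
move=> W subW; have [W0 WD _ _] := subW.
(* A subobject is an arbitrary predicate, so whether it contains a nonzero vector is decided
   classically. *)
have [[v Wv v_neq0]|noW] := Classical_Prop.classic (exists2 v, W v & v <> 0); last first.
  by left=> v Wv; apply: Classical_Prop.NNPP => v0; apply: noW; exists v.
right=> u; have [k vk] : exists k, v k 0 != 0.
  apply/existsP; rewrite -negb_forall; apply/negP => /forallP v0.
  by apply: v_neq0; apply/colP => k; rewrite mxE; apply/eqP.
(* E_jk v = v_k p_j, and the coordinate v_k is invertible. *)
have Wdelta j : W (delta_mx j 0).
  have := WD (v k 0)^-1 _ 0 (subyd_op (units n j k) subW Wv) W0.
  rewrite addr0 op_model rho_units; congr W; apply/colP => l.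
  rewrite !mxE (bigD1 k) //= !mxE eqxx andbT big1 => [|a /negbTE ak].
    by rewrite addr0 mulrCA mulVf // mulr1 ?andbT.
  by rewrite mxE ak andbF mul0r.
have -> : u = \sum_j u j 0 *: delta_mx j 0.
  by rewrite [LHS]matrix_sum_delta; apply: eq_bigr => j _; rewrite big_ord1.
by elim/big_rec: _ => // j w _ Ww; apply: WD.
Qed.

(** A morphism commutes with the sum of the E^n_jj, which is 1 on M_n and 0 on M_m if n and m
    differ; it then vanishes and cannot be injective. *)
Lemma model_inj n m : yd_iso (model (model_of n)) (model (model_of m)) -> n = m.
Proof.
case=> f [lf [g fK _] fact fco]; apply/eqP/negPn/negP => neq_nm.
have f0 x : f x = 0.
  rewrite -[x]mul1mx -(rho_units_sum n) mulmx_suml.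
  have -> : 0 = \sum_(j < ydm_n (model_of n)) rho (model_of m) (units n j j) *m f x.
    by rewrite big1 // => j _; rewrite rho_units0 // mul0mx.
  elim/big_rec2: _ => [|j y1 y2 _ <-]; first exact: linear_at0.
  by rewrite -[_ *m x]scale1r lf scale1r -!op_model (op_morph _ _ lf fact fco).
have [_ [v v_neq0] _] := simple_model n; apply: v_neq0.
by rewrite -[v]fK f0 -(f0 0) fK.
Qed.

(** * Morphisms from the listed modules and the classification *)

Section Columns.
Variables (V : lmodType K) (D : ydstr V).
Hypothesis ydD : is_yd D.
Variables (n j : nat) (d : nat) (v : V).

Definition column_map (x : 'cV[K]_d) : V := \sum_(k < d) x k 0 *: op D (units n k j) v.

Lemma column_map_linear : linear column_map.
Proof.
move=> a x y; rewrite /column_map scaler_sumr -big_split; apply: eq_bigr => k _.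
by rewrite !mxE scalerDl scalerA.
Qed.

Lemma op_column L k :
  op D (column L d n k j) v = \sum_(l < d) ev (entry L l k) *: op D (units n l j) v.
Proof.
by rewrite /op lin_mkseq; apply: eq_bigr => l _; rewrite lin_scale.
Qed.

(** Applied with [f] equal to [act_e] or [co_k] on V, [F] its left multiplication in the double and
    [A] its matrix on M_n. *)
Lemma column_map_morph (f : V -> V) (F : drinfeld -> drinfeld) (A : 'M[K]_d) L x :
  linear f -> (forall s, f (op D s v) = op D (F s) v) -> repmx A L ->
  (forall k : 'I_d, eql (F (units n k j)) (column L d n k j)) ->
  column_map (A *m x) = f (column_map x).
Proof.
move=> lf fop AL eqF.
have -> : f (column_map x) = \sum_(k < d) x k 0 *: op D (column L d n k j) v.
  rewrite /column_map; elim/big_rec2: _ => [|k y1 y2 _ <-]; first exact: linear_at0.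
  by rewrite lf fop /op (eqlP _ (eqF k)).
under [RHS]eq_bigr => k _ do rewrite op_column scaler_sumr.
rewrite exchange_big; apply: eq_bigr => l _; rewrite mxE scaler_suml.
by apply: eq_bigr => k _; rewrite AL scalerA mulrC.
Qed.

End Columns.

(** Kernel and image are subobjects; f v <> 0 forces the kernel to be 0 and the image to be
    everything. *)
Lemma schur (V V' : lmodType K) (D : ydstr V) (D' : ydstr V') (f : V -> V') v :
  simple_yd D -> simple_yd D' -> linear f ->
  (forall e v, f (yd_act D e v) = yd_act D' e (f v)) ->
  (forall k v, f (yd_co D k v) = yd_co D' k (f v)) -> f v <> 0 -> yd_iso D D'.
Proof.
move=> [ydD _ simD] [ydD' _ simD'] lf fact fco fv.
have f0 := linear_at0 lf.
have kerf x : f x = 0 -> x = 0.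
  case: (simD (fun x => f x = 0)) => [|kerD|/(_ v)//]; last exact: kerD.
  split=> // [a x1 x2 fx1 fx2|e x1 fx1|k x1 fx1].
  - by rewrite lf fx1 fx2 scaler0 addr0.
  - by rewrite fact fx1 linear_at0 //; apply: yd_act_linear.
  - by rewrite fco fx1 linear_at0 //; apply: yd_co_linear.
(* The Boolean equality lets [xchoose] produce the inverse map. *)
have surf y : exists x, f x == y.
  case: (simD' (fun y => exists x, f x == y)) => [|im0|]; last exact.
    split=> [|a _ _ [x1 /eqP<-] [x2 /eqP<-]|e _ [x1 /eqP<-]|k _ [x1 /eqP<-]].
    - by exists 0; rewrite f0.
    - by exists (a *: x1 + x2); rewrite lf.
    - by exists (yd_act D e x1); rewrite fact.
    - by exists (yd_co D k x1); rewrite fco.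
  by case: fv; apply: im0; exists v.
exists f; split=> //; exists (fun y => xchoose (surf y)) => [x|y]; last first.
  exact/eqP/(xchooseP (surf y)).
have /eqP fx := xchooseP (surf (f x)); apply/eqP; rewrite -subr_eq0; apply/eqP/kerf.
by rewrite -scaleN1r addrC lf fx scaleN1r addNr.
Qed.

Lemma simple_classification (V : lmodType K) (D : ydstr V) :
  simple_yd D -> exists n : 'I_22, yd_iso (model (model_of n)) D.
Proof.
move=> simD; have [ydD [v v_neq0] _] := simD.
have /existsP[n /existsP[j opv]] : [exists n : 'I_22,
    [exists j : 'I_(ydm_n (model_of n)), op D (units n j j) v != 0]].
  (* If every E^n_jj kills v, so does their sum, the unit of the double, and v = 0. *)
  apply: contra_notT v_neq0 => /existsPn opv0; rewrite -[LHS](op_one ydD) /op.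
  have /eqlP <- := check_sumT.
  rewrite lin_mkseq big1 // => n _; rewrite lin_mkseq -dim_model big1 // => j _.
  by have /existsPn/(_ j)/negPn/eqP := opv0 n.
exists n.
have cols : forall (k : 'I_(ydm_n (model_of n))) e,
    eql (Lact e (units n k j)) (column (cact (csimple n) e) (ydm_n (model_of n)) n k j)
    /\ eql (Lco e (units n k j)) (column (cco (csimple n) e) (ydm_n (model_of n)) n k j).
  move=> k e; have /allP/(_ _ (mem_iota_ord n)) := check_columnsT.
  rewrite (surjective_pairing (tables n)) (surjective_pairing (tables n).1) -dim_model.
  move/allP/(_ _ (mem_iota_ord k))/allP/(_ _ (mem_iota_ord j)).
  by rewrite tablesE => /all_B8sP/(_ e)/andP; rewrite !look_memo.
(* The basis vector p_j goes to E^n_jj v, which is nonzero by the choice of n and j. *)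
apply: (schur (v := delta_mx j 0) _ simD (column_map_linear D n j v)).
- exact: simple_model.
- move=> e x; apply: column_map_morph (yd_act_linear ydD e) _ _ _.
  + by move=> s; apply: act_op.
  + exact: repmx_act (represents_simples n) e.
  + by move=> k; have [] := cols k e.
- move=> e x; apply: column_map_morph (yd_co_linear ydD e) _ _ _.
  + by move=> s; apply: co_op.
  + exact: repmx_co (represents_simples n) e.
  + by move=> k; have [] := cols k e.
rewrite /column_map (bigD1 j) //= mxE !eqxx scale1r big1 ?addr0; first exact/eqP.
by move=> k /negbTE kj; rewrite mxE kj scale0r.
Qed.

End Semantics.

(** * Passage to an arbitrary choice of the square roots *)

Lemma yd_iso_sym (K : fieldType) (V V' : lmodType K) (D : ydstr V) (D' : ydstr V') :
  yd_iso D D' -> yd_iso D' D.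
Proof.
case=> f [lf [g fK gK] fact fco]; have injf := can_inj fK.
exists g; split=> [a u v||e v|k v].
- by apply: injf; rewrite lf !gK.
- by exists f.
- by apply: injf; rewrite fact !gK.
- by apply: injf; rewrite fco !gK.
Qed.

Lemma yd_iso_trans (K : fieldType) (V1 V2 V3 : lmodType K)
    (D1 : ydstr V1) (D2 : ydstr V2) (D3 : ydstr V3) :
  yd_iso D1 D2 -> yd_iso D2 D3 -> yd_iso D1 D3.
Proof.
case=> f [lf bf fact fco] [g [lg bg gact gco]].
exists (g \o f); split=> [a u v||e v|k v] /=.
- by rewrite lf lg.
- exact: bij_comp.
- by rewrite fact gact.
- by rewrite fco gco.
Qed.

(** The conclusion as a property of an indexed family, so that it can be carried along a permutation
    of the indices. *)
Definition classifies (K : fieldType) (M : 'I_22 -> ydmat K) : Prop :=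
  [/\ forall n, simple_yd (model (M n)),
      forall n m, yd_iso (model (M n)) (model (M m)) -> n = m
    & forall (V : lmodType K) (D : ydstr V), simple_yd D ->
        exists! n, yd_iso D (model (M n))].

Lemma classifies_simples (K : fieldType) (z : K) :
  z ^+ 4 = -1 -> 2%:R != 0 :> K -> classifies (simples (z ^+ 2) (z - z ^+ 3) z).
Proof.
move=> z4 two_neq0; split=> [n|n m|V D simD].
- exact: simple_model.
- exact: model_inj.
have [n /yd_iso_sym isoDn] := simple_classification z4 two_neq0 simD.
exists n; split=> // m isoDm; apply: (model_inj z4 two_neq0).
exact: yd_iso_trans (yd_iso_sym isoDn) isoDm.
Qed.

(** Serves to change the sign of sqrt 2, which only permutes the list. *)
Lemma classifies_involution (K : fieldType) (M N : 'I_22 -> ydmat K) (s : 'I_22 -> 'I_22) :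
  involutive s -> (forall n, N n = M (s n)) -> classifies M -> classifies N.
Proof.
move=> sK NM [simM injM clM]; split=> [n|n m|V D simD]; rewrite ?NM //.
  by move/injM/(inv_inj sK).
have [n [isoDn uniq_n]] := clM V D simD.
exists (s n); split=> [|m]; rewrite NM ?sK // => /uniq_n ->; exact: sK.
Qed.

(* Exchanges the two values of [a] in the families W_1 and W_2. *)
Definition swap_idx (n : nat) : nat :=
  if (n < 18)%N then n else if odd n then n.-1 else n.+1.
Definition swap_a (n : 'I_22) : 'I_22 := inord (swap_idx n).

Lemma swap_aE (n : 'I_22) : swap_a n = swap_idx n :> nat.
Proof. by rewrite inordK //; case: n; do 22?case=> //. Qed.

Lemma swap_aK : involutive swap_a.
Proof. by move=> n; apply/val_inj; rewrite /= !swap_aE; case: n; do 22?case=> //. Qed.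

Lemma simples_oppr (K : fieldType) (i s2 si : K) n :
  simples i (- s2) si n = simples i s2 si (swap_a n).
Proof.
rewrite /simples swap_aE; move: (nat_of_ord n) (ltn_ord n) => {}n.
(* The first 18 modules do not involve sqrt 2; the last four form two pairs, each exchanged by the
   sign change. *)
do 18![case: n => [//|n]]; do 2![case: n => [//|n]; case: n => [_|n]; first by rewrite /= opprK].
by [].
Qed.

Theorem theorem3p13 (K : closedFieldType) (i s2 si : K)
    (charK : [pchar K] =i pred0)
    (hi : i ^+ 2 = -1) (hs2 : s2 ^+ 2 = 2) (hsi : si ^+ 2 = i) :
  [/\ (* each of the 22 data defines a simple Yetter-Drinfeld module *)
      (forall n : 'I_22, simple_yd (model (simples i s2 si n))),
      (* they are pairwise non-isomorphic *)
      (forall n m : 'I_22,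
          yd_iso (model (simples i s2 si n)) (model (simples i s2 si m)) -> n = m)
    & (* every simple Yetter-Drinfeld module is isomorphic to exactly one of them *)
      (forall (V : lmodType K) (D : ydstr V), simple_yd D ->
          exists! n : 'I_22, yd_iso D (model (simples i s2 si n)))].
Proof.
(* Thus [si] is a primitive eighth root of unity and takes the place of z. *)
have si4 : si ^+ 4 = -1 by rewrite -hi -hsi -exprM.
have two_neq0 : 2%:R != 0 :> K by rewrite ((pcharf0P K).1 charK).
have cl := classifies_simples si4 two_neq0.
(* Both are square roots of 2, so they agree up to sign. *)
have : s2 ^+ 2 = (si - si ^+ 3) ^+ 2.
  apply/eqP; rewrite hs2 -subr_eq0; apply/eqP.
  transitivity ((si ^+ 4 + 1) * (2 - si ^+ 2)); first by ring.
  by rewrite si4 addNr mul0r.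
(* With equal signs this is the case already treated; with opposite signs the two values of a trade
   places. *)
rewrite -hsi => /eqP; rewrite eqf_sqr => /orP[]/eqP->; first exact: cl.
exact: classifies_involution swap_aK (simples_oppr _ _ _) cl.
Qed.
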